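(* Property [B] fails for the Frail Fighter ($u=0$): there exist an admissible sequence $\{a(j)\}_{j\ge0}$, an integer $n\ge 1$ and a time $t\ge 0$ such that, for $u=0$, $K(n+1,t)<K(n,t)$.
   Context: Fighter problem with discrete ammunition. An admissible sequence is a sequence of probabilities $0=a(0)<a(1)<a(2)<\cdots$ (each $a(j)\in[0,1]$) that is strictly increasing and strictly concave, i.e. $a(j+2)-a(j+1)< a(j+1)-a(j)$ for all $j\ge 0$. Let $u\in[0,1]$. Here $a(j)$ is the probability that an enemy plane is shot down when $j$ missiles are spent on it; if it is not shot down, the fighter survives with probability $u$; enemies arrive according to a Poisson process of rate $1$. Put $c(j)=a(j)+u(1-a(j))$. For $t\ge 0$ (remaining flying time) define inductively on $n$: $N(0,t)=0$; for $r\ge 0$, $N^*(r,t)=e^{-t}\int_0^t N(r,x)e^x\,dx$ (so $N^*(0,t)=0$); for $n\ge 1$ and $1\le j\le n$, $N_n(j,t)=a(j)+c(j)N^*(n-j,t)$; and $N(n,t)=\max_{1\le j\le n}N_n(j,t)$. The optimal spending policy (smallest optimal number of missiles) is, for $n\ge1$, $K(n,t)=\min\{j\in\{1,\dots,n\}: N_n(j,t)=\max_{1\le i\le n}N_n(i,t)\}$. Property [B] is the property that $K(n,t)$ is non-decreasing in $n$ for every fixed $t$. The Frail Fighter is the case $u=0$, for which $c(j)=a(j)$ and $N_n(j,t)=a(j)[1+N^*(n-j,t)]$. *)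

(* Defs.v *)
(* Standard library real numbers, with Coquelicot for the integral. *)
From Stdlib Require Import Reals RList List Lia.
From Coquelicot Require Import Coquelicot.
Import ListNotations.
Open Scope R_scope.

Definition admissible (a : nat -> R) : Prop :=
  a 0%nat = 0 /\
  (forall j, 0 <= a j <= 1) /\
  (forall j, a j < a (S j)) /\
  (forall j, a (S (S j)) - a (S j) < a (S j) - a j).

Definition max_over (n : nat) (f : nat -> R) : R := MaxRlist (map f (seq 1 n)).

Definition c (a : nat -> R) (u : R) (j : nat) : R := a j + u * (1 - a j).

(* The operator f |-> f^* taking N(r, .) to N^*(r, .). *)
Definition star (f : R -> R) (t : R) : R :=
  exp (- t) * RInt (fun x => f x * exp x) 0 t.

(* For 1 <= j, the index [m - pred j] is [S m - j], written so that the recursion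
   is visibly structural; see [N_eq] for the recursion in its usual form. *)
Fixpoint N (a : nat -> R) (u : R) (n : nat) (t : R) {struct n} : R :=
  match n with
  | O => 0
  | S m => max_over (S m) (fun j => a j + c a u j * star (N a u (m - pred j)) t)
  end.

Definition Nstar (a : nat -> R) (u : R) (r : nat) : R -> R := star (N a u r).

(* N_n(j, t), meaningful for 1 <= j <= n. *)
Definition Nj (a : nat -> R) (u : R) (n j : nat) (t : R) : R :=
  a j + c a u j * Nstar a u (n - j) t.

(* The value at n = 0 is a dummy; for n >= 1 the search succeeds, see [K_spec]. *)
Definition K (a : nat -> R) (u : R) (n : nat) (t : R) : nat :=
  match find (fun j => if Req_dec_T (Nj a u n j t) (max_over n (fun i => Nj a u n i t))
                       then true else false) (seq 1 n) with
  | Some j => j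
  | None => O
  end.

Lemma N_eq a u n t : (1 <= n)%nat -> N a u n t = max_over n (fun j => Nj a u n j t).
Proof.
destruct n as [|m]; [lia|]; intros _.
cbn [N]; unfold max_over; f_equal; apply map_ext_in; intros j Hj.
apply in_seq in Hj.
unfold Nj, Nstar; replace (S m - j)%nat with (m - pred j)%nat by lia.
reflexivity.
Qed.

Lemma max_over_ge n f j : (1 <= j <= n)%nat -> f j <= max_over n f.
Proof.
intros Hj; apply MaxRlist_P1, in_map, in_seq; lia.
Qed.

Lemma max_over_attained n f :
  (1 <= n)%nat -> exists j, (1 <= j <= n)%nat /\ f j = max_over n f.
Proof.
intros Hn.
assert (H : In (max_over n f) (map f (seq 1 n))).
{ apply MaxRlist_P2; exists (f 1%nat); apply in_map, in_seq; lia. }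
apply in_map_iff in H; destruct H as [j [Hj Hin]].
apply in_seq in Hin; exists j; split; [lia | exact Hj].
Qed.

Lemma find_seq_first p n s j :
  find p (seq s n) = Some j -> forall i, (s <= i < j)%nat -> p i = false.
Proof.
revert s; induction n as [|n IH]; intros s; cbn; [discriminate|].
destruct (p s) eqn:E; intros H i Hi.
- injection H; lia.
- destruct (Nat.eq_dec i s) as [->|Hne]; [exact E|].
  apply (IH (S s)); [exact H | lia].
Qed.

Lemma K_spec a u n t : (1 <= n)%nat ->
  (1 <= K a u n t <= n)%nat /\
  Nj a u n (K a u n t) t = max_over n (fun i => Nj a u n i t) /\
  (forall j, (1 <= j < K a u n t)%nat ->
     Nj a u n j t <> max_over n (fun i => Nj a u n i t)).
Proof.
intros Hn; unfold K.
set (p := fun j : nat => if Req_dec_T _ _ then true else false).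
destruct (find p (seq 1 n)) as [j|] eqn:E.
- pose proof (find_some _ _ E) as [Hin Hp].
  apply in_seq in Hin; unfold p in Hp.
  destruct (Req_dec_T _ _) as [Hj|] in Hp; [|discriminate].
  repeat split; [lia | lia | exact Hj |].
  intros i Hi; pose proof (find_seq_first _ _ _ _ E i Hi) as Hf.
  unfold p in Hf; destruct (Req_dec_T _ _) in Hf; [discriminate | assumption].
- destruct (max_over_attained n (fun i => Nj a u n i t) Hn) as [j [Hj Heq]].
  assert (Hin : In j (seq 1 n)) by (apply in_seq; lia).
  pose proof (find_none _ _ E j Hin) as Hf.
  unfold p in Hf; destruct (Req_dec_T _ _) in Hf; [discriminate | contradiction].
Qed.

(* Main.v *)
From Stdlib Require Import Reals List Lia Lra.
From Coquelicot Require Import Coquelicot.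
Require Import Defs.
Open Scope R_scope.

(** The failure is already visible in the limit of infinite flying time.  If [f] tends to [l]
at infinity then so does [star f], so [N(n,t)] tends to the solution [V] of the algebraic
recursion [V 0 = 0], [V n = max_j (a j + c j * V (n - j))], and a policy that is strictly
suboptimal for the limiting values is suboptimal for all large [t].  For [u = 0] and
[1 - a j = 1, 1/2, 1/4, 1/10, 1/20, 1/40, ...] one gets [1 + V = 1, 3/2, 7/4, 17/8, ...]; the
strict maximum of [a j * (1 + V (4 - j))] is at [j = 3] (27/20 against 21/16 at [j = 2]), that
of [a j * (1 + V (5 - j))] at [j = 2] (51/32 against 63/40 at [j = 3]). *)

(** * Limits of finite maxima and of affine images *)

(** If both arguments move by less than [eps], so does their maximum. *)
Lemma filterlim_Rmax {T : Type} (F : (T -> Prop) -> Prop) {FF : Filter F}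
    (f g : T -> R) (x y : R) :
  filterlim f F (locally x) -> filterlim g F (locally y) ->
  filterlim (fun t => Rmax (f t) (g t)) F (locally (Rmax x y)).
Proof.
intros Hf Hg; apply filterlim_locally; intros eps.
generalize (filter_and _ _ (proj1 (filterlim_locally _ _) Hf eps)
                           (proj1 (filterlim_locally _ _) Hg eps)).
apply filter_imp; intros t [Hx Hy].
apply Rabs_def2 in Hx, Hy; unfold minus, plus, opp in Hx, Hy; simpl in Hx, Hy.
apply Rabs_def1; unfold minus, plus, opp; simpl; unfold Rmax;
  destruct (Rle_dec _ _), (Rle_dec _ _); lra.
Qed.

Lemma filterlim_max_over {T : Type} (F : (T -> Prop) -> Prop) {FF : Filter F}
    (n : nat) (g : nat -> T -> R) (l : nat -> R) :
  (forall j, (1 <= j <= n)%nat -> filterlim (g j) F (locally (l j))) ->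
  filterlim (fun t => max_over n (fun j => g j t)) F (locally (max_over n l)).
Proof.
intros H; unfold max_over.
assert (Hs : forall j, In j (seq 1 n) -> filterlim (g j) F (locally (l j))).
{ intros j Hj; apply in_seq in Hj; apply H; lia. }
(* The three cases are those of [MaxRlist]: it is [0] on the empty list, the sole element on a
   singleton, and an [Rmax] otherwise. *)
clear H; induction (seq 1 n) as [|i [|i' s] IH].
- apply filterlim_const.
- apply Hs; left; reflexivity.
- apply (filterlim_Rmax F).
  + apply Hs; left; reflexivity.
  + apply IH; intros j Hj; apply Hs; right; exact Hj.
Qed.

Lemma filterlim_affine {T : Type} (F : (T -> Prop) -> Prop) {FF : Filter F}
    (b k : R) (f : T -> R) (l : R) :
  filterlim f F (locally l) ->
  filterlim (fun t => b + k * f t) F (locally (b + k * l)).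
Proof.
intros Hf.
apply (filterlim_comp _ _ _ f (fun x => b + k * x) F (locally l)); [exact Hf|].
apply (ex_derive_continuous (fun x => b + k * x)); auto_derive; trivial.
Qed.

(** * Continuity and limit at infinity of [star f] *)

Lemma continuous_mult_exp (f : R -> R) (f_cont : forall x, continuous f x) x :
  continuous (fun x => f x * exp x) x.
Proof.
apply (continuous_mult f exp); [apply f_cont | apply continuous_exp].
Qed.

Lemma ex_RInt_mult_exp (f : R -> R) (f_cont : forall x, continuous f x) s t :
  ex_RInt (fun x => f x * exp x) s t.
Proof.
apply (ex_RInt_continuous (V := R_CompleteNormedModule)); intros x _.
apply continuous_mult_exp, f_cont.
Qed.

Lemma continuous_star (f : R -> R) (f_cont : forall x, continuous f x) t :
  continuous (star f) t.
Proof.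
apply (continuous_mult (fun t => exp (- t))).
- apply (ex_derive_continuous (fun t => exp (- t))); auto_derive; trivial.
- apply (ex_derive_continuous (RInt (fun x => f x * exp x) 0)).
  exists (f t * exp t); apply (is_derive_RInt (fun x => f x * exp x) _ 0).
  + apply filter_forall; intros y; apply (RInt_correct (V := R_CompleteNormedModule)).
    apply ex_RInt_mult_exp, f_cont.
  + apply (continuous_mult_exp f f_cont t).
Qed.

Lemma is_RInt_scal_exp m s t : is_RInt (fun x => m * exp x) s t (m * exp t - m * exp s).
Proof.
apply (is_RInt_derive (fun x => m * exp x)); intros x _.
- auto_derive; [trivial | ring].
- apply (continuous_mult (fun _ => m) exp); [apply continuous_const | apply continuous_exp].
Qed.

Lemma star_split (f : R -> R) (f_cont : forall x, continuous f x) s t :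
  star f t = exp (- t) * (RInt (fun x => f x * exp x) 0 s + RInt (fun x => f x * exp x) s t).
Proof.
unfold star; f_equal; symmetry.
apply (RInt_Chasles (V := R_CompleteNormedModule)); apply ex_RInt_mult_exp, f_cont.
Qed.

(** Beyond some [s], [f] lies within [eps / 2] of [l]. Replacing it on [[s, t]] by the constants
    [l + eps / 2] and [l - eps / 2] encloses [star f t], and the weight [exp (- t)] makes the
    contribution of [[0, s]] vanish. *)
Lemma is_lim_star (f : R -> R) (f_cont : forall x, continuous f x) (l : R) :
  is_lim f p_infty l -> is_lim (star f) p_infty l.
Proof.
intros Hf; apply is_lim_spec in Hf; apply is_lim_spec; intros eps.
assert (He : 0 < eps / 2) by (generalize (cond_pos eps); lra).
destruct (Hf (mkposreal _ He)) as [s Hs]; simpl in Hs.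
set (A := RInt (fun x => f x * exp x) 0 s).
(* This is the difference between [star f t] and [b] when [f] is the constant [b] on [[s, t]]. *)
assert (Htail : forall b, is_lim (fun t => exp (- t) * (A - b * exp s)) p_infty 0).
{ intros b; replace (Finite 0) with (Rbar_mult 0 (A - b * exp s)) by (simpl; f_equal; ring).
  apply is_lim_scal_r.
  apply (is_lim_comp exp (fun t => - t) p_infty 0 m_infty).
  - apply is_lim_exp_m.
  - apply (is_lim_opp (fun t => t) p_infty p_infty), is_lim_id.
  - exists 0; intros y _; discriminate. }
assert (Hup := proj2 (is_lim_spec _ _ _) (Htail (l + eps / 2)) (mkposreal _ He)).
assert (Hlo := proj2 (is_lim_spec _ _ _) (Htail (l - eps / 2)) (mkposreal _ He)).
assert (Hgt : Rbar_locally p_infty (fun t => s < t)) by (exists s; trivial).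
generalize (filter_and _ _ Hgt (filter_and _ _ Hup Hlo)).
apply filter_imp; intros t [Ht [H1 H2]]; simpl in H1, H2.
apply Rabs_def2 in H1, H2.
assert (Hint : forall m,
  (forall x, s < x < t -> f x <= m) -> RInt (fun x => f x * exp x) s t <= m * exp t - m * exp s).
{ intros m Hm; rewrite <- (is_RInt_unique _ _ _ _ (is_RInt_scal_exp m s t)).
  apply RInt_le; [lra | apply ex_RInt_mult_exp, f_cont | eexists; apply is_RInt_scal_exp |].
  intros x Hx; apply Rmult_le_compat_r; [left; apply exp_pos | apply Hm, Hx]. }
assert (Hint' : forall m,
  (forall x, s < x < t -> m <= f x) -> m * exp t - m * exp s <= RInt (fun x => f x * exp x) s t).
{ intros m Hm; rewrite <- (is_RInt_unique _ _ _ _ (is_RInt_scal_exp m s t)).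
  apply RInt_le; [lra | eexists; apply is_RInt_scal_exp | apply ex_RInt_mult_exp, f_cont |].
  intros x Hx; apply Rmult_le_compat_r; [left; apply exp_pos | apply Hm, Hx]. }
specialize (Hint (l + eps / 2)); specialize (Hint' (l - eps / 2)).
assert (Hfx : forall x, s < x < t -> l - eps / 2 <= f x <= l + eps / 2).
{ intros x Hx; assert (H := Hs x (proj1 Hx)); apply Rabs_def2 in H; lra. }
assert (Hu := Hint (fun x Hx => proj2 (Hfx x Hx))).
assert (Hl := Hint' (fun x Hx => proj1 (Hfx x Hx))).
rewrite (star_split f f_cont s t); fold A.
assert (Hpos := exp_pos (- t)).
assert (Hinv : exp (- t) * exp t = 1) by (rewrite <- exp_plus, Rplus_opp_l; apply exp_0).
apply (Rmult_le_compat_l (exp (- t))) in Hu, Hl; try lra.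
assert (Hexp : forall b,
  exp (- t) * (b * exp t - b * exp s) = b - exp (- t) * (b * exp s)).
{ intros b; transitivity (b * (exp (- t) * exp t) - exp (- t) * (b * exp s)); [ring|].
  rewrite Hinv; ring. }
rewrite Hexp in Hu, Hl; rewrite Rmult_plus_distr_l.
rewrite Rmult_minus_distr_l in H1, H2.
apply Rabs_def1; lra.
Qed.

(** * Convergence to the limiting recursion *)

(** Supplies the continuity that [is_lim_star] asks for. The induction is strong because the
    recursion reaches back to all smaller indices. *)
Lemma continuous_N a u n t : continuous (N a u n) t.
Proof.
revert t; induction n as [n IH] using (well_founded_induction Wf_nat.lt_wf); intros t.
destruct n as [|m]; [apply continuous_const|].
apply (filterlim_max_over (locally t) (S m)
         (fun j t => a j + c a u j * star (N a u (m - pred j)) t)); intros j Hj.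
apply (filterlim_affine (locally t)), continuous_star.
intros x; apply IH; lia.
Qed.

(** The values called [V] above, indexed exactly as in [N] so that the two recursions match term by
    term. *)
Fixpoint Ninf (a : nat -> R) (u : R) (n : nat) {struct n} : R :=
  match n with
  | O => 0
  | S m => max_over (S m) (fun j => a j + c a u j * Ninf a u (m - pred j))
  end.

Definition Njinf (a : nat -> R) (u : R) (n j : nat) : R :=
  a j + c a u j * Ninf a u (n - j).

Lemma is_lim_N a u n : is_lim (N a u n) p_infty (Ninf a u n).
Proof.
induction n as [n IH] using (well_founded_induction Wf_nat.lt_wf).
destruct n as [|m]; [apply (is_lim_const 0 p_infty)|].
apply (filterlim_max_over (Rbar_locally' p_infty) (S m)
         (fun j t => a j + c a u j * star (N a u (m - pred j)) t)
         (fun j => a j + c a u j * Ninf a u (m - pred j))); intros j Hj.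
apply (filterlim_affine (Rbar_locally' p_infty)).
apply (is_lim_star _ (continuous_N a u _)), IH; lia.
Qed.

Lemma is_lim_Nj a u n j : is_lim (Nj a u n j) p_infty (Njinf a u n j).
Proof.
apply (filterlim_affine (Rbar_locally' p_infty)).
apply (is_lim_star _ (continuous_N a u _)), is_lim_N.
Qed.

Lemma K_neq_of_lt a u n t j k :
  (1 <= k <= n)%nat -> Nj a u n j t < Nj a u n k t -> K a u n t <> j.
Proof.
intros Hk Hlt <-.
destruct (K_spec a u n t) as [_ [Hmax _]]; [lia|].
generalize (max_over_ge n (fun i => Nj a u n i t) k Hk); cbv beta; lra.
Qed.

(** A strict gap between limits persists for large [t], so the policy can be located by excluding
    values one at a time. *)
Lemma K_neq_eventually a u n j k :
  (1 <= k <= n)%nat -> Njinf a u n j < Njinf a u n k ->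
  Rbar_locally p_infty (fun t => K a u n t <> j).
Proof.
intros Hk Hlt.
(* Neighbourhoods of half the gap around the two limits are disjoint. *)
assert (He : 0 < (Njinf a u n k - Njinf a u n j) / 2) by lra.
assert (Hj := proj2 (is_lim_spec _ _ _) (is_lim_Nj a u n j) (mkposreal _ He)).
assert (Hk' := proj2 (is_lim_spec _ _ _) (is_lim_Nj a u n k) (mkposreal _ He)).
generalize (filter_and _ _ Hj Hk').
apply filter_imp; intros t [H1 H2]; simpl in H1, H2.
apply (K_neq_of_lt a u n t j k Hk).
apply Rabs_def2 in H1, H2; lra.
Qed.

(** * The counterexample *)

(** With [1 - (/ 2) ^ j] throughout, spending 2 or 3 out of 4 would tie at 21/16. The factor [4 / 5]
    raises [a 3] from 7/8 to 9/10, which breaks the tie in favour of 3, yet stays below 51/56, so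
    that 2 still beats 3 out of 5. *)
Definition frail_a (j : nat) : R :=
  1 - (if Nat.leb j 2 then 1 else 4 / 5) * (/ 2) ^ j.

Lemma admissible_frail_a : admissible frail_a.
Proof.
assert (Hp : forall j, 0 < (/ 2) ^ j) by (intros j; apply pow_lt; lra).
assert (H1 : forall j, (/ 2) ^ j <= 1).
{ intros j; rewrite <- (pow1 j); apply pow_incr; lra. }
unfold frail_a; split; [simpl; lra|].
split; [|split].
- intros j; generalize (Hp j) (H1 j); destruct (Nat.leb j 2); lra.
(* The factor changes between 2 and 3: small indices are numerical, and from 3 on everything is
   linear in [(/ 2) ^ j]. *)
- intros [|[|[|j]]]; simpl; try lra; generalize (Hp j); lra.
- intros [|[|[|j]]]; simpl; try lra; generalize (Hp j); lra.
Qed.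

Lemma Ninf_frail_1 : Ninf frail_a 0 1 = 1 / 2.
Proof. unfold Ninf, max_over, c, frail_a; simpl; field. Qed.

Lemma Ninf_frail_2 : Ninf frail_a 0 2 = 3 / 4.
Proof.
change (Ninf frail_a 0 2) with
  (Rmax (frail_a 1 + c frail_a 0 1 * Ninf frail_a 0 1) (frail_a 2 + c frail_a 0 2 * 0)).
rewrite Ninf_frail_1; unfold c, frail_a; simpl.
(* Both candidates equal 3/4. *)
apply Rmax_case; field.
Qed.

Lemma Ninf_frail_3 : Ninf frail_a 0 3 = 9 / 8.
Proof.
change (Ninf frail_a 0 3) with
  (Rmax (frail_a 1 + c frail_a 0 1 * Ninf frail_a 0 2)
     (Rmax (frail_a 2 + c frail_a 0 2 * Ninf frail_a 0 1) (frail_a 3 + c frail_a 0 3 * 0))).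
rewrite Ninf_frail_1, Ninf_frail_2; unfold c, frail_a; simpl.
(* The candidates are 7/8, 9/8 and 9/10; the inner maximum is resolved first. *)
rewrite (Rmax_left (_ + _ * (1 / 2))) by lra.
rewrite Rmax_right by lra; field.
Qed.

Theorem mainTheorem6 :
  exists (a : nat -> R) (n : nat) (t : R),
    admissible a /\ (1 <= n)%nat /\ 0 <= t /\
    (K a 0 (n + 1) t < K a 0 n t)%nat.
Proof.
(* Excluding 1 and 2 at [n = 4] forces [K] to be at least 3; excluding 3, 4 and 5 at [n = 5] forces
   it to be at most 2. *)
assert (H41 : Njinf frail_a 0 4 1 < Njinf frail_a 0 4 3).
{ unfold Njinf; simpl (4 - _)%nat; rewrite Ninf_frail_1, Ninf_frail_3.
  unfold c, frail_a; simpl; lra. }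
assert (H42 : Njinf frail_a 0 4 2 < Njinf frail_a 0 4 3).
{ unfold Njinf; simpl (4 - _)%nat; rewrite Ninf_frail_1, Ninf_frail_2.
  unfold c, frail_a; simpl; lra. }
assert (H53 : Njinf frail_a 0 5 3 < Njinf frail_a 0 5 2).
{ unfold Njinf; simpl (5 - _)%nat; rewrite Ninf_frail_2, Ninf_frail_3.
  unfold c, frail_a; simpl; lra. }
assert (H54 : Njinf frail_a 0 5 4 < Njinf frail_a 0 5 2).
{ unfold Njinf; simpl (5 - _)%nat; rewrite Ninf_frail_1, Ninf_frail_3.
  unfold c, frail_a; simpl; lra. }
assert (H55 : Njinf frail_a 0 5 5 < Njinf frail_a 0 5 2).
{ unfold Njinf; simpl (5 - _)%nat; rewrite Ninf_frail_3; simpl (Ninf _ _ 0).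
  unfold c, frail_a; simpl; lra. }
assert (Hlarge : Rbar_locally p_infty (fun t =>
  K frail_a 0 4 t <> 1%nat /\ K frail_a 0 4 t <> 2%nat /\ K frail_a 0 5 t <> 3%nat /\
  K frail_a 0 5 t <> 4%nat /\ K frail_a 0 5 t <> 5%nat)).
{ repeat apply filter_and; (eapply K_neq_eventually; [|eassumption]; lia). }
destruct Hlarge as [T HT].
set (t := Rmax 0 T + 1).
assert (Ht : T < t) by (unfold t; generalize (Rmax_r 0 T); lra).
assert (Ht0 : 0 <= t) by (unfold t; generalize (Rmax_l 0 T); lra).
exists frail_a, 4%nat, t.
split; [exact admissible_frail_a|]; split; [lia|]; split; [exact Ht0|].
simpl (4 + 1)%nat.
specialize (HT t Ht).
destruct (K_spec frail_a 0 4 t) as [HK4 _]; [lia|].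
destruct (K_spec frail_a 0 5 t) as [HK5 _]; [lia|].
lia.
Qed.
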